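(* Let $p$ be a prime, let $m,n$ be the dimensions (ranks) of the free $\mathbb{Z}/p^2$-modules $W=(\mathbb{Z}/p^2)^m$ and $V=(\mathbb{Z}/p^2)^n$, and let $\phi$ be a random $m\times n$ matrix whose entries are chosen i.i.d. from the discrete uniform distribution on $\{0,1,2,\ldots,p^2-1\}$, regarded as a $\mathbb{Z}/p^2$-linear map $\phi:V\to W$. Let $\overline{\phi}:\overline{V}\to\overline{W}$ be its reduction modulo $p$, and let $\beta_\phi\in\operatorname{Hom}(\ker\overline{\phi},\operatorname{coker}\overline{\phi})$ be the Bockstein homomorphism of $\phi$. Let $\psi:\overline{V}\to\overline{W}$ be a $\mathbb{Z}/p$-linear map, let $k=\dim_{\mathbb{Z}/p}(\ker\psi)$, and let $\beta\in\operatorname{Hom}(\ker\psi,\operatorname{coker}\psi)$. Then $$\mathbb{P}\big(\beta_\phi=\beta \,\big|\, \overline{\phi}=\psi\big)=\frac{1}{p^{k(m-n+k)}}.$$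
   Context: For a free $\mathbb{Z}/p^2$-module $V$, $\overline{V}=V/pV$ denotes its reduction modulo $p$, a $\mathbb{Z}/p$-vector space, and $\overline{x}$ denotes the class of $x\in V$. A $\mathbb{Z}/p^2$-linear map $\phi:V\to W$ induces a $\mathbb{Z}/p$-linear map $\overline{\phi}:\overline{V}\to\overline{W}$. For $\psi:\overline{V}\to\overline{W}$, $\operatorname{coker}\psi=\overline{W}/\psi(\overline{V})$. $\operatorname{Hom}(\ker\psi,\operatorname{coker}\psi)$ is the space of $\mathbb{Z}/p$-linear maps. Bockstein homomorphism: let $\phi:V\to W$ be $\mathbb{Z}/p^2$-linear with $\overline{\phi}=\psi$. For $\overline{v}\in\ker\psi$ choose any representative $v\in V$; then $\phi(v)=pw$ for some $w\in W$. The Bockstein homomorphism sends $\overline{v}$ to $pw+\phi(pV)\in pW/\phi(pV)$; identifying $pW/\phi(pV)$ with $\operatorname{coker}\psi$ via the isomorphism $pw+\phi(pV)\mapsto\overline{w}+\psi(\overline{V})$, it is the $\mathbb{Z}/p$-linear map $\beta_\phi:\ker\psi\to\operatorname{coker}\psi$, $\beta_\phi(\overline{v})=\overline{w}+\psi(\overline{V})$. *)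

(* Defs.v *)
From HB Require Import structures.
From mathcomp Require Import all_boot all_order all_algebra.
From mathcomp Require Import all_classical all_reals all_analysis.

Set Implicit Arguments.
Unset Strict Implicit.
Unset Printing Implicit Defensive.

Import Order.TTheory GRing.Theory Num.Theory.

Local Open Scope classical_set_scope.
Local Open Scope ring_scope.

Section QuotientSpace.
Variables (K : fieldType) (vT : vectType K) (U : {vspace vT}).

(* The library's [Quotient.quot] only carries the additive group structure; the
   scalar action is added below. *)
Definition vquot : Type := Quotient.quot (pred_of_vspace U).

HB.instance Definition _ := GRing.Zmodule.on vquot.

Definition vclass (x : vT) : vquot :=
  (\pi_(Quotient.quot (pred_of_vspace U)) x)%qT.

Definition vquot_scale (a : K) (q : vquot) : vquot :=
  vclass (a *: repr (q : Quotient.quot (pred_of_vspace U))).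

Lemma vclass_eq (x y : vT) : (vclass x = vclass y) <-> (x - y \in U).
Proof.
rewrite (Quotient.idealrBE (pred_of_vspace U) x y) /vclass.
by split=> [->|/eqP].
Qed.

Lemma vclass_surj (q : vquot) : exists x, q = vclass x.
Proof.
by exists (repr (q : Quotient.quot (pred_of_vspace U))); rewrite /vclass reprK.
Qed.

Lemma vclassD : {morph vclass : x y / x + y}.
Proof. by move=> x y; apply: Quotient.pi_add. Qed.

Lemma vclass_scale a x : vquot_scale a (vclass x) = vclass (a *: x).
Proof.
apply/vclass_eq; rewrite -scalerBr; apply: memvZ.
by apply/vclass_eq; rewrite /vclass reprK.
Qed.

Lemma vquot_scalerA a b v :
  vquot_scale a (vquot_scale b v) = vquot_scale (a * b) v.
Proof. by have [x ->] := vclass_surj v; rewrite !vclass_scale scalerA. Qed.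

Lemma vquot_scale1r : left_id 1 vquot_scale.
Proof. by move=> v; have [x ->] := vclass_surj v; rewrite vclass_scale scale1r. Qed.

Lemma vquot_scalerDr : right_distributive vquot_scale +%R.
Proof.
move=> a u v; have [x ->] := vclass_surj u; have [y ->] := vclass_surj v.
by rewrite -vclassD !vclass_scale scalerDr vclassD.
Qed.

Lemma vquot_scalerDl v : {morph vquot_scale^~ v : a b / a + b}.
Proof.
by move=> a b; have [x ->] := vclass_surj v; rewrite !vclass_scale scalerDl vclassD.
Qed.

HB.instance Definition _ := GRing.Zmodule_isLmodule.Build K vquot
  vquot_scalerA vquot_scale1r vquot_scalerDr vquot_scalerDl.

Lemma vclass_linear : linear vclass.
Proof. by move=> a x y; rewrite vclassD -vclass_scale. Qed.

HB.instance Definition _ := GRing.isLinear.Build K vT vquot _ vclass vclass_linear.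

End QuotientSpace.

Definition coker (K : fieldType) (aT rT : vectType K) (f : 'Hom(aT, rT)) :=
  vquot (limg f).

Section ReductionModP.
Variable p : nat.

(* For [p] prime, ['F_p] is [Z/pZ] and the reduction [V / pV] of
   [V = (Z/p^2)^n] is identified with ['cV['F_p]_n], the class of [x] being its
   entrywise residue; see [red_mx_surj] and [red_mx_eq0]. *)
Definition redp (x : 'Z_(p ^ 2)) : 'F_p := (val x)%:R.

Definition red_mx m n (A : 'M['Z_(p ^ 2)]_(m, n)) : 'M['F_p]_(m, n) :=
  map_mx redp A.

Definition red_hom m n (phi : 'M['Z_(p ^ 2)]_(m, n)) :
    'Hom('cV['F_p]_n, 'cV['F_p]_m) :=
  linfun (mulmx (red_mx phi)).

Hypothesis p_prime : prime p.

Let p2_gt1 : (1 < p ^ 2)%N.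
Proof. by rewrite -(exp1n 2) ltn_exp2r // prime_gt1. Qed.

Lemma redp_nat (a : nat) : redp a%:R = a%:R.
Proof.
rewrite /redp /= val_Zp_nat // -(Fp_nat_mod p_prime).
by rewrite modn_dvdm ?Fp_nat_mod // dvdn_exp.
Qed.

Lemma redp_additive : {morph redp : x y / x + y}.
Proof.
by move=> x y; rewrite -[x]natr_Zp -[y]natr_Zp -natrD !redp_nat natrD.
Qed.

Lemma redp_mul : {morph redp : x y / x * y}.
Proof.
by move=> x y; rewrite -[x]natr_Zp -[y]natr_Zp -natrM !redp_nat natrM.
Qed.

Lemma redp_surj (y : 'F_p) : exists x, redp x = y.
Proof. by exists (val y)%:R; rewrite redp_nat natr_Zp. Qed.

Lemma redp_eq0 (x : 'Z_(p ^ 2)) : redp x = 0 <-> exists y, x = p%:R * y.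
Proof.
split=> [|[y ->]]; last first.
  by rewrite redp_mul redp_nat pchar_Fp_0 // mul0r.
move=> /(congr1 (fun z => nat_of_ord z)); rewrite /redp val_Fp_nat //= => x0.
have /dvdnP[a xa] : (p %| val x)%N by rewrite /dvdn; apply/eqP.
by exists a%:R; rewrite -natrM mulnC -xa natr_Zp.
Qed.

Lemma redpp : redp p%:R = 0.
Proof. by apply/redp_eq0; exists 1; rewrite mulr1. Qed.

Lemma red_mxD m n : {morph (@red_mx m n) : A B / A + B}.
Proof. by move=> A B; apply/matrixP=> i j; rewrite !mxE redp_additive. Qed.

Lemma red_mxZ m n a (A : 'M['Z_(p ^ 2)]_(m, n)) : red_mx (a *: A) = redp a *: red_mx A.
Proof. by apply/matrixP=> i j; rewrite !mxE redp_mul. Qed.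

Lemma red_mxM m n k (A : 'M['Z_(p ^ 2)]_(m, n)) (B : 'M['Z_(p ^ 2)]_(n, k)) :
  red_mx (A *m B) = red_mx A *m red_mx B.
Proof.
have redp0 : redp 0 = 0 by rewrite -(mulr0n 1) redp_nat.
apply/matrixP=> i j; rewrite !mxE (big_morph redp redp_additive redp0).
by apply: eq_bigr => l _; rewrite !mxE redp_mul.
Qed.

Lemma red_mx_surj m n (B : 'M['F_p]_(m, n)) : exists A, red_mx A = B.
Proof.
exists (map_mx (fun y : 'F_p => (val y)%:R) B).
by apply/matrixP=> i j; rewrite !mxE redp_nat natr_Zp.
Qed.

Lemma red_mx_eq0 m n (A : 'M['Z_(p ^ 2)]_(m, n)) :
  red_mx A = 0 <-> exists B, A = p%:R *: B.
Proof.
split=> [A0|[B ->]]; last by rewrite red_mxZ redpp scale0r.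
have {}A0 i j : exists y, A i j == p%:R * y.
  have /redp_eq0[y yE] : redp (A i j) = 0.
    by move/matrixP/(_ i j): A0; rewrite !mxE.
  by exists y; apply/eqP.
exists (\matrix_(i, j) xchoose (A0 i j)).
by apply/matrixP=> i j; rewrite !mxE; apply/eqP/(xchooseP (A0 i j)).
Qed.

Lemma red_homE m n (phi : 'M['Z_(p ^ 2)]_(m, n)) (v : 'cV_n) :
  red_hom phi (red_mx v) = red_mx (phi *m v).
Proof. by rewrite lfunE /= red_mxM. Qed.

End ReductionModP.

Section Bockstein.
Variables (p m n : nat).
Implicit Types (phi : 'M['Z_(p ^ 2)]_(m, n)).
Implicit Types (psi : 'Hom('cV['F_p]_n, 'cV['F_p]_m)).

(* Only meaningful when [red_hom phi = psi] and [p] is prime: a pair [(v, w)]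
   as required then exists, the value does not depend on it ([bocksteinE]),
   and [bockstein phi psi] is linear ([bockstein_linear]). The default value
   [0] is never used in that case. *)
Definition bockstein phi psi (u : subvs_of (lker psi)) : coker psi :=
  if [pick vw : 'cV['Z_(p ^ 2)]_n * 'cV['Z_(p ^ 2)]_m
       | (red_mx vw.1 == vsval u) && (phi *m vw.1 == p%:R *: vw.2)]
  is Some vw then vclass (limg psi) (red_mx vw.2) else 0.

Hypothesis p_prime : prime p.

Lemma bockstein_rep phi psi (u : subvs_of (lker psi)) : red_hom phi = psi ->
  exists v w, red_mx v = vsval u /\ phi *m v = p%:R *: w.
Proof.
move=> psiE; have [v vu] := red_mx_surj p_prime (vsval u).
have /(red_mx_eq0 p_prime)[w wE] : red_mx (phi *m v) = 0.
  rewrite -red_homE // psiE vu; apply/eqP; rewrite -memv_ker; exact: subvsP.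
by exists v, w.
Qed.

Lemma scale_p_eq0 (w : 'cV['Z_(p ^ 2)]_m) : p%:R *: w = 0 -> red_mx w = 0.
Proof.
move=> pw0; apply/matrixP=> i j; rewrite !mxE.
have pwij : p%:R * w i j = 0 by move/matrixP/(_ i j): pw0; rewrite !mxE.
have p2_gt1 : (1 < p ^ 2)%N by rewrite -(exp1n 2) ltn_exp2r // prime_gt1.
move: pwij; rewrite -[w i j]natr_Zp -natrM => /(congr1 val) /eqP.
rewrite /= val_Zp_nat //.
move: (val (w i j)) => a; rewrite -/(dvdn _ _).
rewrite redp_nat // expnS expn1 dvdn_pmul2l ?prime_gt0 // => pa.
apply/eqP; rewrite -(dvdn_pcharf (pchar_Fp p_prime)) //.
Qed.

Lemma bocksteinE phi psi (u : subvs_of (lker psi)) v w : red_hom phi = psi ->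
  red_mx v = vsval u -> phi *m v = p%:R *: w ->
  bockstein phi u = vclass (limg psi) (red_mx w).
Proof.
move=> psiE vu vw; rewrite /bockstein; case: pickP => [[v' w']|/(_ (v, w))] /=.
  case/andP=> /eqP vu' /eqP vw'; apply/vclass_eq.
  have redB k (x y : 'cV['Z_(p ^ 2)]_k) : red_mx (x - y) = red_mx x - red_mx y.
    by apply/eqP; rewrite eq_sym subr_eq -red_mxD // subrK.
  have /(red_mx_eq0 p_prime)[z zE] : red_mx (v' - v) = 0.
    by rewrite redB vu vu' subrr.
  have : red_mx (w' - w - phi *m z) = 0.
    apply: scale_p_eq0; rewrite !scalerBr -vw' -vw -mulmxBr zE.
    by rewrite -scalemxAr subrr.
  move/eqP; rewrite redB subr_eq0 redB => /eqP ->.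
  by rewrite -red_homE // psiE memv_img // memvf.
by rewrite vu vw !eqxx.
Qed.

Lemma bockstein_linear phi psi : red_hom phi = psi ->
  linear (@bockstein phi psi).
Proof.
move=> psiE a u u'.
have [v [w [vu vw]]] := bockstein_rep u psiE.
have [v' [w' [vu' vw']]] := bockstein_rep u' psiE.
have [b ba] := redp_surj p_prime a.
rewrite (bocksteinE psiE vu vw) (bocksteinE psiE vu' vw') -linearP.
rewrite (@bocksteinE phi psi _ (b *: v + v') (b *: w + w')) //.
- by rewrite red_mxD // red_mxZ // ba.
- by rewrite red_mxD // red_mxZ // ba vu vu' linearP.
- by rewrite mulmxDr -scalemxAr vw vw' scalerDr !scalerA mulrC.
Qed.

End Bockstein.

Section Probability.
Context d (T : measurableType d) (R : realType) (P : probability T R).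

Definition cond_prob (A B : set T) : R := fine (P (A `&` B)) / fine (P B).

Definition mutually_independent (I : finType) d' (T' : measurableType d')
    (X : I -> {RV P >-> T'}) : Prop :=
  forall (J : {set I}) (E : I -> set T'), (forall i, measurable (E i)) ->
    P (\bigcap_(i in [set` J]) (X i @^-1` E i)) =
    (\prod_(i in J) P (X i @^-1` E i))%E.

(* For [0 < N] these masses add up to [1]: no mass lies outside [{0, .., N-1}]. *)
Definition discrete_uniform (N : nat) (X : {RV P >-> nat}) : Prop :=
  forall a : nat, (a < N)%N -> P (X @^-1` [set a]) = (N%:R^-1 : R)%:E.

End Probability.

(* Main.v *)
Require Import Defs.
From HB Require Import structures.
From mathcomp Require Import all_boot all_order all_algebra.
From mathcomp Require Import all_classical all_reals all_analysis.

Set Implicit Arguments.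
Unset Strict Implicit.
Unset Printing Implicit Defensive.

Import Order.TTheory GRing.Theory Num.Theory.

Local Open Scope classical_set_scope.
Local Open Scope ring_scope.

(** The entries of [phi] are independent and uniform on [Z/p^2], so [phi] is a
    uniformly random matrix over [Z/p^2] ([uniform_residue_matrix]) and the conditional probability is a quotient
    of two cardinals.

    Fix a lift [M0] of [psi].  Since [p^2 = 0], the lifts of [psi] are exactly
    the matrices [M0 + p N], where only the residue [N] of the perturbation
    modulo [p] matters; this makes them a torsor under ['M['F_p]_(m, n)]
    ([fiber_mx_inj], [fiber_mxP]).  Perturbing the lift moves the Bockstein map
    additively, by the composite of [N] with the inclusion of [ker psi] and the
    projection onto [coker psi] ([bockstein_fiber_mx]).

    Describe the inclusion by a matrix [K] whose columns are a basis of
    [ker psi], and the projection by a matrix [C] of full row rank [s] whose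
    kernel is [im psi]; rank-nullity gives [s = m - n + k]
    ([coker_mx]).  The event that the Bockstein map is [beta] becomes an
    equation [C N K = G] with values in ['M['F_p]_(s, k)].  As [C] has a right
    inverse and [K] a left inverse, the additive map [N |-> C N K] is onto, so
    all its fibres have the same size, the fraction [1 / p^(k s)] of all
    matrices [N] ([card_fiber_sandwich]). *)

(** * Linear algebra over a field *)

(** [C] and [K] being one-sidedly invertible, every value [H] is attained, at
    [C' H K'], and translation by [C' (H - G) K'] carries the fibre over [G] to
    the fibre over [H]: the fibres partition all matrices into parts of equal
    size. *)
Lemma card_fiber_sandwich (F : finFieldType) m n s k
    (C : 'M[F]_(s, m)) (C' : 'M[F]_(m, s))
    (K : 'M[F]_(n, k)) (K' : 'M[F]_(k, n)) (G : 'M[F]_(s, k)) :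
    C *m C' = 1%:M -> K' *m K = 1%:M ->
  (#|[set N : 'M[F]_(m, n) | C *m N *m K == G]%SET| * #|F| ^ (s * k)
   = #|F| ^ (m * n))%N.
Proof.
move=> CC' K'K.
pose fib (H : 'M[F]_(s, k)) := [set N : 'M[F]_(m, n) | C *m N *m K == H]%SET.
have fibE H : #|fib H| = #|fib G|.
  pose N0 := C' *m (H - G) *m K'.
  have CN0K : C *m N0 *m K = H - G.
    by rewrite /N0 !mulmxA CC' mul1mx -mulmxA K'K mulmx1.
  rewrite -(card_imset (mem (fib G)) (addrI N0)); apply: eq_card => N.
  apply/idP/imsetP => [|[N1]]; rewrite !inE.
    move=> /eqP NH; exists (N - N0); last by rewrite addrC subrK.
    by rewrite inE mulmxBr mulmxBl NH CN0K subKr.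
  by move=> /eqP N1G ->; rewrite mulmxDr mulmxDl N1G CN0K subrK.
rewrite -!card_mx -[RHS]sum1_card.
rewrite (partition_big (fun N : 'M[F]_(m, n) => C *m N *m K) predT) //=.
rewrite -[LHS]mulnC -sum_nat_const; apply: eq_bigr => H _.
by rewrite -/(fib G) -(fibE H) -sum1dep_card; apply: eq_bigl => N; rewrite ?inE.
Qed.

Lemma lfun_mulmx (F : fieldType) m n (psi : 'Hom('cV[F]_n, 'cV[F]_m)) :
  exists Q : 'M[F]_(m, n), psi = linfun (mulmx Q).
Proof.
exists (\matrix_(i, j) psi (delta_mx j 0) i 0); apply/lfunP => v.
rewrite lfunE /=; apply/colP => i; rewrite [v in LHS]matrix_sum_delta.
rewrite linear_sum mxE summxE; apply: eq_bigr => j _.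
by rewrite big_ord1 linearZ !mxE mulrC.
Qed.

Definition ker_basis_mx (F : fieldType) m n (psi : 'Hom('cV[F]_n, 'cV[F]_m)) :
    'M[F]_(n, \dim (lker psi)) :=
  \matrix_(i, j) (vbasis (lker psi))`_j i 0.

Section KernelBasis.
Variables (F : fieldType) (m n : nat) (psi : 'Hom('cV[F]_n, 'cV[F]_m)).
Let K := ker_basis_mx psi.

Lemma mul_ker_basis_mx c :
  K *m c = \sum_j c j 0 *: (vbasis (lker psi))`_j.
Proof.
apply/colP => i; rewrite mxE summxE; apply: eq_bigr => j _.
by rewrite !mxE mulrC.
Qed.

Lemma ker_basis_mx_free : row_free K^T.
Proof.
rewrite -kermx_eq0; apply/eqP/row_matrixP => i; rewrite row0.
have : row i (kermx K^T) *m K^T = 0 by apply/sub_kermxP/row_sub.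
move: (row i _) => r /(congr1 trmx).
rewrite trmx_mul trmxK trmx0 mul_ker_basis_mx => r0.
have /freeP/(_ _ r0) r00 := basis_free (vbasisP (lker psi)).
by apply/rowP => j; rewrite mxE -(r00 j) mxE.
Qed.

Lemma ker_basis_mx_linv : exists K', K' *m K = 1%:M.
Proof.
have [K' KK'] := row_freeP ker_basis_mx_free; exists K'^T.
by rewrite -[K]trmxK -trmx_mul KK' trmx1.
Qed.

Lemma memv_ker_basis_mx (v : 'cV_n) : (v \in lker psi) = (v^T <= K^T)%MS.
Proof.
apply/idP/submxP => [vk|[D]].
  exists (\row_j coord (vbasis (lker psi)) j v).
  apply: (can_inj (@trmxK _ _ _)); rewrite trmx_mul !trmxK mul_ker_basis_mx.
  by rewrite {1}(coord_vbasis vk); apply: eq_bigr => j _; rewrite !mxE.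
move=> /(congr1 trmx); rewrite trmx_mul !trmxK mul_ker_basis_mx => ->.
apply: memv_suml => j _; apply: memvZ; apply: vbasis_mem.
by rewrite mem_nth // size_tuple.
Qed.

End KernelBasis.

(** The two ways of measuring the kernel of a matrix agree: [\dim] counts a
    basis of column vectors, [\rank] works with row spaces, so the matrix is
    transposed on one side. *)
Lemma dim_lker_mulmx (F : fieldType) m n (Q : 'M[F]_(m, n)) :
  (\dim (lker (linfun (mulmx Q : 'cV_n -> 'cV_m))) + \rank Q = n)%N.
Proof.
set psi := linfun _.
have kerE : ((ker_basis_mx psi)^T :=: kermx Q^T)%MS.
  apply/eqmxP/andP; split; apply/rV_subP => v;
    rewrite -[v]trmxK -memv_ker_basis_mx memv_ker lfunE /=.
    by move/eqP => Qv; apply/sub_kermxP; rewrite -trmx_mul Qv trmx0.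
  move/sub_kermxP; rewrite -trmx_mul => /(congr1 trmx).
  by rewrite trmxK trmx0 => ->.
have <- : (n - \rank Q)%N = \dim (lker psi).
  by apply: etrans (eqP (ker_basis_mx_free psi)); rewrite kerE mxrank_ker mxrank_tr.
by rewrite subnK // rank_leq_col.
Qed.

(** The rows of [C] are a basis of the linear forms that vanish on [im psi]: an
    explicit coordinate system on [coker psi], whose dimension [s] is then
    [m - n + k] by rank-nullity. *)
Lemma coker_mx (F : fieldType) m n (psi : 'Hom('cV[F]_n, 'cV[F]_m)) :
  exists (s : nat) (C : 'M[F]_(s, m)) (C' : 'M[F]_(m, s)),
    [/\ (s + n = m + \dim (lker psi))%N, C *m C' = 1%:M
      & forall w, (w \in limg psi) = (C *m w == 0)].
Proof.
have [Q ->] := lfun_mulmx psi; set k := \dim _.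
have [B BE] : exists B, B = cokermx Q^T by exists (cokermx Q^T).
have [C' CC'] : exists C', (col_base B)^T *m C' = 1%:M.
  by apply/row_freeP; rewrite /row_free mxrank_tr; apply: col_base_full.
exists (\rank B), (col_base B)^T, C'; split => // [|w].
  rewrite BE mxrank_coker mxrank_tr.
  have : (k + \rank Q = n)%N := dim_lker_mulmx Q.
  move: k (\rank Q) (rank_leq_row Q) => k r r_le <-.
  by rewrite [(k + r)%N]addnC addnA subnK.
have -> : (w \in limg (linfun (mulmx Q : 'cV_n -> 'cV_m))) = (w^T <= Q^T)%MS.
  apply/memv_imgP/submxP => [[v _ ->]|[D wD]].
    by exists v^T; rewrite lfunE -trmx_mul.
  exists D^T; rewrite ?memvf // lfunE /=.
  by apply: (can_inj (@trmxK _ _ _)); rewrite wD trmx_mul trmxK.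
(* the columns of the square cokernel matrix are dependent; its column base
   cuts out the same space with independent equations *)
rewrite submxE -BE -[B in LHS]mulmx_base mulmxA.
rewrite mulmx_free_eq0 ?row_base_free //.
by apply/eqP/eqP => /(congr1 trmx); rewrite trmx_mul ?trmxK trmx0.
Qed.

Lemma eq_linear_vbasis (K : fieldType) (vT : vectType K) (U : {vspace vT})
    (V : lmodType K) (f g : {linear subvs_of U -> V}) :
  (forall j : 'I_(\dim U), f (vsproj U (vbasis U)`_j) = g (vsproj U (vbasis U)`_j)) ->
  f =1 g.
Proof.
move=> fg u; rewrite -[u]vsvalK (coord_vbasis (subvsP u)) !linear_sum.
by apply: eq_bigr => j _; rewrite !linearZ /= fg.
Qed.

(** * The lifts of a linear map and their Bockstein maps *)

Section BocksteinCount.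
Variables (p : nat) (p_prime : prime p).

Lemma red_mxB m n : {morph (@red_mx p m n) : A B / A - B}.
Proof.
by move=> A B; apply/eqP; rewrite eq_sym subr_eq -red_mxD // subrK.
Qed.

(** Multiplication by [p] induces an isomorphism from [V / pV] to [pV], because
    [pV] is also the kernel of multiplication by [p] on a free
    [Z/p^2]-module [V]. *)
Lemma scale_p_red_mx m n (A B : 'M['Z_(p ^ 2)]_(m, n)) :
  (p%:R *: A == p%:R *: B) = (red_mx A == red_mx B).
Proof.
rewrite -subr_eq0 -scalerBr -[RHS]subr_eq0 -red_mxB.
move: (A - B) => {A B} A; apply/eqP/eqP => [pA|/(red_mx_eq0 p_prime)[B ->]].
  apply/matrixP => i j.
  have /(scale_p_eq0 p_prime)/colP/(_ i) : p%:R *: col j A = 0.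
    by rewrite -linearZ /= pA linear0.
  by rewrite !mxE.
rewrite scalerA -natrM mulnn [X in X *: B](_ : _ = 0) ?scale0r //.
have p2_gt1 : (1 < p ^ 2)%N by rewrite -(exp1n 2) ltn_exp2r // prime_gt1.
by apply: val_inj; rewrite /= val_Zp_nat // modnn.
Qed.

Lemma red_hom_linfun m n (M : 'M['Z_(p ^ 2)]_(m, n)) Q :
  (red_hom M == linfun (mulmx Q)) = (red_mx M == Q).
Proof.
apply/eqP/eqP => [/lfunP MQ|<-//]; apply/matrixP => i j.
have := MQ (delta_mx j 0); rewrite !lfunE /= -!colE => /colP/(_ i).
by rewrite !mxE.
Qed.

Lemma red_hom_surj m n (psi : 'Hom('cV['F_p]_n, 'cV['F_p]_m)) :
  exists M, red_hom M = psi.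
Proof.
have [Q ->] := lfun_mulmx psi; have [M /eqP MQ] := red_mx_surj p_prime Q.
by exists M; apply/eqP; rewrite red_hom_linfun.
Qed.

Definition lift_mx m n (N : 'M['F_p]_(m, n)) : 'M['Z_(p ^ 2)]_(m, n) :=
  map_mx (fun y : 'F_p => (val y)%:R) N.

Lemma lift_mxK m n : cancel (@lift_mx m n) (@red_mx p m n).
Proof. by move=> N; apply/matrixP=> i j; rewrite !mxE redp_nat // natr_Zp. Qed.

Section Fiber.
Variables (m n : nat) (psi : 'Hom('cV['F_p]_n, 'cV['F_p]_m)).
Variables (M0 : 'M['Z_(p ^ 2)]_(m, n)) (M0psi : red_hom M0 = psi).

Definition fiber_mx (N : 'M['F_p]_(m, n)) : 'M['Z_(p ^ 2)]_(m, n) :=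
  M0 + p%:R *: lift_mx N.

Lemma fiber_mx_inj : injective fiber_mx.
Proof.
by move=> N N' /addrI/eqP; rewrite scale_p_red_mx !lift_mxK => /eqP.
Qed.

Lemma fiber_mxP M : reflect (exists N, M = fiber_mx N) (red_hom M == psi).
Proof.
rewrite -M0psi red_hom_linfun -subr_eq0 -red_mxB.
apply: (iffP eqP) => [/(red_mx_eq0 p_prime)[B MB]|[N ->]].
  exists (red_mx B); rewrite /fiber_mx -[LHS](subrK M0) MB addrC; congr (_ + _).
  by apply/eqP; rewrite scale_p_red_mx lift_mxK.
by rewrite /fiber_mx addrC addKr red_mxZ // redpp // scale0r.
Qed.

Lemma red_hom_fiber_mx N : red_hom (fiber_mx N) = psi.
Proof. by apply/eqP/fiber_mxP; exists N. Qed.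

Lemma card_red_hom_fiber :
  #|[set M | red_hom M == psi]%SET| = (p ^ (m * n))%N.
Proof.
have := card_mx 'F_p m n; rewrite card_Fp // => <-.
rewrite -cardsT -(card_imset _ fiber_mx_inj); apply: eq_card => M.
rewrite inE; apply/fiber_mxP/imsetP => [[N ->]|[N _ ->]]; last by exists N.
by exists N; rewrite ?inE.
Qed.

(** A vector [v] that lifts [u] satisfies [(M0 + p N) v = p (w + N v)] as soon
    as [M0 v = p w], so the perturbation adds the class of [N u]. *)
Lemma bockstein_fiber_mx N (u : subvs_of (lker psi)) :
  bockstein (fiber_mx N) u = bockstein M0 u + vclass (limg psi) (N *m vsval u).
Proof.
have Npsi := red_hom_fiber_mx N.
have [v [w [vu vw]]] := bockstein_rep p_prime u M0psi.
rewrite (bocksteinE p_prime M0psi vu vw).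
rewrite (@bocksteinE _ _ _ p_prime _ _ _ v
  (w + lift_mx N *m v) Npsi vu).
  by rewrite red_mxD // red_mxM // lift_mxK vu vclassD.
by rewrite mulmxDl vw -scalemxAl scalerDr.
Qed.

(** In the basis [K] of the kernel and the coordinates [C] on the cokernel, to
    prescribe the Bockstein map of [M0 + p N] is to prescribe the matrix
    [C N K]. *)
Lemma bockstein_fiber_mx_eq s (C : 'M['F_p]_(s, m))
    (beta : {linear subvs_of (lker psi) -> coker psi}) :
    (forall w, (w \in limg psi) = (C *m w == 0)) ->
  exists G, forall N, `[< bockstein (fiber_mx N) (psi := psi) =1 beta >]
                      = (C *m N *m ker_basis_mx psi == G).
Proof.
move=> imE; set K := ker_basis_mx psi.
pose e (j : 'I_(\dim (lker psi))) := vsproj (lker psi) (vbasis (lker psi))`_j.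
have eK j : vsval (e j) = col j K.
  rewrite vsprojK; first by apply/colP => i; rewrite !mxE.
  by rewrite vbasis_mem // mem_nth // size_tuple.
(* column [j] of [Y] represents the class that [N] has to add at [e j] *)
have /fin_all_exists[y yE] : forall j,
    exists x, beta (e j) - bockstein M0 (e j) = vclass (limg psi) x.
  by move=> j; apply: vclass_surj.
pose Y := \matrix_(i, j) y j i 0; exists (C *m Y) => N.
have bE j : bockstein (fiber_mx N) (e j) = beta (e j) <->
            col j (C *m N *m K) = col j (C *m Y).
  rewrite bockstein_fiber_mx -[beta _](subrK (bockstein M0 (e j))) addrC yE.
  have -> : y j = col j Y by apply/colP => i; rewrite !mxE.
  split=> [/addIr/vclass_eq|CNK].
    by rewrite imE mulmxBr subr_eq0 => /eqP; rewrite eK !colE !mulmxA.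
  congr (_ + _); apply/vclass_eq; rewrite imE mulmxBr subr_eq0 eK.
  by move: CNK; rewrite !colE !mulmxA => ->.
pose bN : {linear subvs_of (lker psi) -> coker psi} :=
  HB.pack (@bockstein p m n (fiber_mx N) psi)
    (GRing.isLinear.Build _ _ _ _ _
      (bockstein_linear p_prime (red_hom_fiber_mx N))).
apply/asboolP/eqP => [bb|/matrixP CNK].
  apply/matrixP => i j; have /bE/colP/(_ i) := bb (e j).
  by rewrite !mxE.
apply: (eq_linear_vbasis (f := bN)) => j; apply/bE/colP => i.
by have := CNK i j; rewrite !mxE.
Qed.

End Fiber.

(** The exponent [k s] is the dimension of [Hom(ker psi, coker psi)]: all
    [p ^ (k s)] Bockstein maps share the lifts of [psi] equally. *)
Lemma card_bockstein_fiber m n (psi : 'Hom('cV['F_p]_n, 'cV['F_p]_m))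
    (beta : {linear subvs_of (lker psi) -> coker psi}) (k := \dim (lker psi)) :
  exists2 s, (s + n = m + k)%N &
    (#|[set M | (red_hom M == psi)
              && `[< bockstein M (psi := psi) =1 beta >]]%SET| * p ^ (k * s)
     = p ^ (m * n))%N.
Proof.
have [s [C [C' [sE CC' imE]]]] := coker_mx psi.
have [K' K'K] := ker_basis_mx_linv psi.
have [M0 M0psi] := red_hom_surj psi.
have [G GE] := bockstein_fiber_mx_eq M0psi beta imE.
exists s => //; have := card_fiber_sandwich G CC' K'K; rewrite card_Fp // => <-.
rewrite [(k * s)%N]mulnC; congr (_ * _)%N.
rewrite -(card_imset _ (fiber_mx_inj (M0 := M0))); apply: eq_card => M.
rewrite inE; apply/andP/imsetP => [[/(fiber_mxP M0psi)[N ->]]|[N + ->]].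
  by rewrite GE => NG; exists N; rewrite ?inE.
by rewrite inE -GE => NG; split=> //; apply/(fiber_mxP M0psi); exists N.
Qed.

End BocksteinCount.

(** * Uniform random matrices modulo N *)

Section UniformMatrix.
Context d (T : measurableType d) (R : realType) (P : probability T R).

Lemma probability_finite_fibers (I : finType) (f : T -> I) (S : pred I) :
  (forall i, measurable (f @^-1` [set i])) ->
  P [set t | f t \in S] = (\sum_(i in S) P (f @^-1` [set i]))%E.
Proof.
move=> mf.
have -> : [set t | f t \in S] = \bigcup_(i in [set` S]) f @^-1` [set i].
  by apply/seteqP; split=> [t /= ft|t [i /= iS /= ->//]]; exists (f t).
rewrite measure_fin_bigcup //; last by move=> i j _ _ [t [/= <- <-]].
by rewrite -(bigfs _ (index_enum_uniq I)) // => i _; rewrite mem_index_enum.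
Qed.

Lemma measurable_RV_nat (X : {RV P >-> nat}) (A : set nat) :
  measurable (X @^-1` A).
Proof. by rewrite -[_ @^-1` _]setTI; exact: (measurable_funP X). Qed.

(** The event contains [X = z], of probability [1 / N]. The [N] residue events
    partition the whole space, so their probabilities, all at least [1 / N],
    add up to [1] and cannot exceed [1 / N]; this takes care of the null set on
    which [X] is at least [N]. *)
Lemma discrete_uniform_residue N (X : {RV P >-> nat}) (z : 'Z_N) :
    (1 < N)%N -> discrete_uniform N X ->
  P [set t | (X t)%:R = z] = (N%:R^-1 : R)%:E.
Proof.
move=> N_gt1 X_unif; have N_gt0 := ltnW N_gt1.
pose E (y : 'Z_N) := [set t | (X t)%:R = y].
have mE y : measurable (E y) by apply: measurable_RV_nat [set a | a%:R = y].
have E_ge y : ((N%:R^-1 : R)%:E <= P (E y))%E.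
  have y_lt : (val y < N)%N by rewrite -[X in (_ < X)%N](Zp_cast N_gt1) ltn_ord.
  rewrite -(X_unif _ y_lt); apply: le_measure; rewrite ?inE //.
    exact: measurable_RV_nat.
  by move=> t /= Xt; rewrite /E /= Xt natr_Zp.
have PE y : P (E y) = (fine (P (E y)))%:E.
  by rewrite fineK // fin_num_measure.
have sumE : \sum_y (fine (P (E y)) - N%:R^-1) = 0.
  apply/eqP; rewrite sumrB subr_eq0; apply/eqP.
  have -> : \sum_(y : 'Z_N) N%:R^-1 = 1 :> R.
    by rewrite sumr_const card_ord -[LHS]mulr_natl Zp_cast // divff // pnatr_eq0 -lt0n.
  apply: EFin_inj.
  rewrite -sumEFin -(probability_setT P).
  under eq_bigr do rewrite -PE.
  rewrite -(probability_finite_fibers (f := fun t => (X t)%:R) predT) //.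
  by congr (P _); apply/seteqP; split.
rewrite -[LHS]/(P (E z)) PE; congr EFin; apply/eqP; rewrite -subr_eq0; apply/eqP.
apply: (psumr_eq0P _ sumE) => // y _.
by rewrite subr_ge0 -lee_fin -PE.
Qed.

Lemma uniform_residue_matrix N m n (X : 'I_m * 'I_n -> {RV P >-> nat})
    (S : pred 'M['Z_N]_(m, n)) :
    (1 < N)%N -> (forall ij, discrete_uniform N (X ij)) ->
    mutually_independent X ->
  P [set t | (\matrix_(i, j) (X (i, j) t)%:R : 'M['Z_N]_(m, n)) \in S]
    = (#|S|%:R / (N ^ (m * n))%:R : R)%:E.
Proof.
move=> N_gt1 X_unif X_indep.
pose E (M : 'M['Z_N]_(m, n)) ij := [set a : nat | a%:R = M ij.1 ij.2].
have fibE (M : 'M['Z_N]_(m, n)) :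
    (fun t => \matrix_(i, j) (X (i, j) t)%:R) @^-1` [set M]
    = \bigcap_(ij in [set` [set: 'I_m * 'I_n]%SET]) (X ij @^-1` E M ij).
  apply/seteqP; split=> [t /= /matrixP XM [i j] _|t /= XM].
    by rewrite /E /= -(XM i j) mxE.
  by apply/matrixP => i j; rewrite mxE; apply: (XM (i, j)); rewrite /= inE.
rewrite probability_finite_fibers => [|M]; last first.
  by rewrite fibE; apply: fin_bigcap_measurable => // ij _; exact: measurable_RV_nat.
rewrite (eq_bigr (fun=> ((N ^ (m * n))%:R^-1 : R)%:E)) => [|M _].
  by rewrite sumEFin sumr_const [in RHS]mulr_natl.
rewrite fibE X_indep //.
rewrite (eq_bigr (fun=> (N%:R^-1 : R)%:E)) => [|ij _].
  by rewrite prodEFin prodr_const cardsT card_prod !card_ord natrX exprVn.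
exact: (discrete_uniform_residue (M ij.1 ij.2) N_gt1 (X_unif ij)).
Qed.

End UniformMatrix.

(** * The conditional law of the Bockstein map *)

Theorem theorem5p2 (p m n : nat) (d : measure_display) (T : measurableType d)
    (R : realType) (P : probability T R)
    (X : 'I_m * 'I_n -> {RV P >-> nat})
    (p_prime : prime p)
    (X_unif : forall ij, discrete_uniform (p ^ 2) (X ij))
    (X_indep : mutually_independent X)
    (psi : 'Hom('cV['F_p]_n, 'cV['F_p]_m))
    (beta : {linear subvs_of (lker psi) -> coker psi}) :
  let phi (t : T) : 'M['Z_(p ^ 2)]_(m, n) :=
    \matrix_(i < m, j < n) (X (i, j) t)%:R in
  let k := \dim (lker psi) in
  cond_prob P [set t | @bockstein p m n (phi t) psi =1 beta]
              [set t | red_hom (phi t) = psi]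
  = ((p%:R : R) ^ (k%:Z * (m%:Z - n%:Z + k%:Z)))^-1.
Proof.
move=> phi k.
have p2_gt1 : (1 < p ^ 2)%N by rewrite -(exp1n 2) ltn_exp2r // prime_gt1.
have [s sE cardAB] := card_bockstein_fiber p_prime beta.
have [M0 M0psi] := red_hom_surj p_prime psi.
have cardA := card_red_hom_fiber p_prime M0psi.
set A := [set M | red_hom M == psi]%SET in cardA.
set AB := [set M | _ & _]%SET in cardAB.
have -> : m%:Z - n%:Z + k%:Z = s%:Z by rewrite addrAC -PoszD -sE PoszD addrK.
rewrite /cond_prob.
have -> : [set t | red_hom (phi t) = psi] = [set t | phi t \in A].
  by apply/seteqP; split=> t /=; rewrite inE => /eqP.
have -> : [set t | bockstein (phi t) (psi := psi) =1 beta] `&` [set t | phi t \in A]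
        = [set t | phi t \in AB].
  apply/seteqP; split=> t /=; rewrite !inE.
    by case=> /asboolT -> ->.
  by case/andP=> -> /asboolW.
rewrite !uniform_residue_matrix // cardA -cardAB /=.
rewrite -PoszM -exprnP natrM.
have AB_neq0 : #|AB|%:R != 0 :> R.
  by rewrite pnatr_eq0; apply/eqP => AB0; move: cardAB; rewrite AB0 mul0n
    => /esym/eqP; rewrite -leqn0 leqNgt expn_gt0 prime_gt0.
have D_neq0 : ((p ^ 2) ^ (m * n))%:R != 0 :> R.
  by rewrite pnatr_eq0 -lt0n !expn_gt0 prime_gt0.
by rewrite invf_div mulrA divfK // natrX invfM mulrA divff // mul1r.
Qed.
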